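(* Let $\mathcal{A}\in\mathbb{R}^{d_1\times\cdots\times d_k}$ be an arbitrary order-$k$ real tensor and let $\pi_1,\pi_2\in\mathcal{P}_{[k]}$ be any two partitions. Then: (a) for any $1\le p\le 2$, \[ \frac{[\dim(\mathcal{A})]^{-1/p}}{[\dim_{\mathcal{A}}(\pi_1,\pi_2)]^{-1/2}}\|\mathrm{Unfold}_{\pi_1}(\mathcal{A})\|_p\le\|\mathrm{Unfold}_{\pi_2}(\mathcal{A})\|_p\le\frac{[\dim(\mathcal{A})]^{1/p}}{[\dim_{\mathcal{A}}(\pi_2,\pi_1)]^{1/2}}\|\mathrm{Unfold}_{\pi_1}(\mathcal{A})\|_p; \] (b) for any $2\le p\le\infty$, \[ \frac{[\dim(\mathcal{A})]^{\frac1p-1}}{[\dim_{\mathcal{A}}(\pi_1,\pi_2)]^{-1/2}}\|\mathrm{Unfold}_{\pi_1}(\mathcal{A})\|_p\le\|\mathrm{Unfold}_{\pi_2}(\mathcal{A})\|_p\le\frac{[\dim(\mathcal{A})]^{1-\frac1p}}{[\dim_{\mathcal{A}}(\pi_2,\pi_1)]^{1/2}}\|\mathrm{Unfold}_{\pi_1}(\mathcal{A})\|_p . \]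
   Context: $\dim(\mathcal{A})=\prod_{n=1}^k d_n$. For a real tensor $\mathcal{T}\in\mathbb{R}^{e_1\times\cdots\times e_m}$ and $1\le p\le\infty$, $\|\mathcal{T}\|_p=\sup\{\sum t_{i_1\dots i_m}x^{(1)}_{i_1}\cdots x^{(m)}_{i_m}:\ \mathbf{x}_n\in\mathbb{R}^{e_n},\ \|\mathbf{x}_n\|_p=1\}$ (the norm of the associated multilinear functional, with $\|\mathbf{x}_n\|_p$ the vector $l^p$-norm). $\mathcal{P}_{[k]}$ is the set of partitions of $[k]$. Unfolding: for $\pi=\{B_1,\dots,B_\ell\}\in\mathcal{P}_{[k]}$, $\mathrm{Unfold}_\pi(\mathcal{A})$ is the order-$\ell$ tensor of dimensions $(\prod_{j\in B_1}d_j,\dots,\prod_{j\in B_\ell}d_j)$ whose entry at $(m_1,\dots,m_\ell)$ is $a_{i_1\dots i_k}$, where $m_j$ corresponds to $(i_r)_{r\in B_j}$ under a fixed bijection $\prod_{r\in B_j}[d_r]\to[\prod_{r\in B_j}d_r]$. For $\pi_1,\pi_2\in\mathcal{P}_{[k]}$, $\dim_{\mathcal{A}}(\pi_1,\pi_2)=\prod_{B\in\pi_1}\max_{B'\in\pi_2}D_{\mathcal{A}}(B,B')$ with $D_{\mathcal{A}}(B,B')=\prod_{n\in B\cap B'}d_n$ if $B\cap B'\ne\emptyset$ and $0$ otherwise. *)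

(* Defs.v *)
From HB Require Import structures.
From mathcomp Require Import all_boot all_order all_algebra.
From mathcomp Require Import all_classical all_reals all_analysis.
Set Implicit Arguments. Unset Strict Implicit. Unset Printing Implicit Defensive.
Import Order.TTheory GRing.Theory Num.Theory.
Local Open Scope ring_scope.


Section Defs.
Variable R : realType.

Definition lpnorm (I : finType) (p : \bar R) (x : I -> R) : R :=
  match p with
  | r%:E => (\sum_(i : I) `|x i| `^ r) `^ r^-1
  | +oo%E => \big[Num.max/0]_(i : I) `|x i|
  | -oo%E => 0
  end.

Definition invp (p : \bar R) : R :=
  match p with r%:E => r^-1 | _ => 0 end.

(* ||T||_p of a tensor whose modes are indexed by the finite type J,
   mode j having (finite) index set E j: norm of the multilinear functional *)
Definition tensor_norm (J : finType) (E : J -> finType) (p : \bar R)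
    (T : {dffun forall j : J, E j} -> R) : R :=
  sup [set s : R | exists x : forall j : J, E j -> R,
         (forall j, lpnorm p (x j) = 1) /\
         s = \sum_(m : {dffun forall j : J, E j}) T m * \prod_(j : J) x j (m j)]%classic.
End Defs.

Section Tensor.
Variables (k : nat) (d : 'I_k -> nat).

Definition tindex := {dffun forall n : 'I_k, 'I_(d n)}.

Definition blockidx (B : {set 'I_k}) : finType :=
  {dffun forall r : {r : 'I_k | r \in B}, 'I_(d (val r))}.

Definition restr (B : {set 'I_k}) (i : tindex) : blockidx B :=
  [ffun r => i (val r)].

Definition is_partition (P : {set {set 'I_k}}) : bool :=
  finset.partition P [set: 'I_k].

Definition blocks (P : {set {set 'I_k}}) : finType := {B : {set 'I_k} | B \in P}.

Definition unfold_idx (P : {set {set 'I_k}}) : finType :=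
  {dffun forall B : blocks P, blockidx (val B)}.

(* Unfold_P(A): the tensor with one mode per block B of P, indexed by
   the tuples (i_r)_{r in B}; its entry at m is a_i for the unique i
   whose restriction to each block B is m B *)
Definition Unfold (R : pzRingType) (P : {set {set 'I_k}}) (A : tindex -> R)
    : unfold_idx P -> R :=
  fun m => \sum_(i : tindex | [forall B : blocks P, restr (val B) i == m B]) A i.

Definition dimA : nat := \prod_(n : 'I_k) d n.

Definition DA (B B' : {set 'I_k}) : nat :=
  if B :&: B' != finset.set0 then \prod_(n in B :&: B') d n else 0.

Definition dimA2 (P1 P2 : {set {set 'I_k}}) : nat :=
  \prod_(B in P1) \max_(B' in P2) DA B B'.
End Tensor.

Definition unfold_norm (R : realType) (k : nat) (d : 'I_k -> nat)
    (p : \bar R) (P : {set {set 'I_k}}) (A : tindex d -> R) : R :=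
  @tensor_norm R (blocks P) (fun B => blockidx d (val B)) p (@Unfold k d R P A).

(* Main.v *)
Require Import Defs.
From HB Require Import structures.
From mathcomp Require Import all_boot all_order all_algebra.
From mathcomp Require Import all_classical all_reals all_analysis.
From mathcomp Require Import lra.
Import Order.TTheory GRing.Theory Num.Theory.
Local Open Scope ring_scope.

(** For every [1 <= p <= oo] one has
    [||Unfold_P2 A||_p <= N ^ (1 - 1/p) * ||Unfold_P1 A||_p] with
    [N = dim A / dim_A(P2, P1)]; both parts follow by comparing exponents, and
    the lower bounds are the upper bounds with [P1] and [P2] exchanged.

    Attach to each block [B] of [P2] a block [c B] of [P1] of maximal overlap,
    and let [O] be the set of modes [n] not in [c B] for the block [B] of [P2]
    containing [n], so that there are [N] multi-indices over [O]. Freezing the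
    modes in [O] cuts a product of vectors indexed by the blocks of [P2] into
    [N] slices, each of which is also a product over the blocks of [P1]. By
    distributivity the [p]-th powers of the norms of the slices add up to [1],
    so by Hoelder's inequality the norms add up to at most [N ^ (1 - 1/p)]. *)

(** * Sums and products over dependent functions *)

Lemma sum_prod_dffun (R : comPzSemiRingType) (J : finType) (E : J -> finType)
    (f : forall j, E j -> R) :
  \sum_(m : {dffun forall j, E j}) \prod_j f j (m j) = \prod_j \sum_(e : E j) f j e.
Proof.
rewrite (reindex (@dffun_of_fprod J E)); last exact/onW_bij/dffun_of_fprod_bij.
transitivity (\sum_(t : fprod E) \prod_(j in J) [ffun e => f j e] (t j)).
  by apply: eq_bigr => t _; apply: eq_bigr => j _; rewrite !ffunE.
rewrite (@big_fprod R 0 1 *%R +%R J E (fun j => [ffun e => f j e])).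
(* Pooling all [E j] in the sigma type gives the functions a codomain independent of [j], where
   ordinary distributivity applies. *)
rewrite -(@bigA_distr_big_dep R 0 1 *%R +%R J {i : J & E i}
  (fun j => tagged_with E j) (fun j => untag 0 [ffun e => f j e])).
apply: eq_bigr => j _.
rewrite -(@big_tag R 0 +%R J E (fun j => [ffun e => f j e])).
by apply: eq_bigr => e _; rewrite ffunE.
Qed.

Lemma card_dffun (J : finType) (E : J -> finType) :
  #|{dffun forall j, E j}| = (\prod_j #|E j|)%N.
Proof. by rewrite card_dep_ffun foldrE big_image. Qed.

(** * Vector norms *)

Section LpNorm.
Context {R : realType} {I : finType}.
Implicit Types (p : \bar R) (x : I -> R).

Lemma lpnorm_ge0 p x : 0 <= lpnorm p x.
Proof.
case: p => [r| |] //=; first exact: powR_ge0.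
by apply: (big_ind (fun y => 0 <= y)) => // a b a0 b0; rewrite le_max a0.
Qed.

Lemma lpnorm_powR (r : R) x : r != 0 ->
  lpnorm r%:E x `^ r = \sum_i `|x i| `^ r.
Proof.
move=> r0; rewrite /= -powRrM mulVf // powRr1 //.
by apply: sumr_ge0 => i _; apply: powR_ge0.
Qed.

Lemma normr_le_lpnorm p x i : (1%:E <= p)%E -> `|x i| <= lpnorm p x.
Proof.
case: p => [r| |] //= => [|_]; last exact: le_bigmax.
rewrite lee_fin => r1; have r0 : 0 < r by apply: lt_le_trans r1.
rewrite -[X in X <= _](@powRr1 R) // -(mulfV (lt0r_neq0 r0)) powRrM.
apply: ge0_ler_powR; rewrite ?invr_ge0 ?nnegrE ?powR_ge0 //; first exact: ltW.
  by apply: sumr_ge0 => j _; apply: powR_ge0.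
by rewrite (bigD1 i) //= lerDl; apply: sumr_ge0 => j _; apply: powR_ge0.
Qed.

Lemma lpnormZ p (a : R) x : (1%:E <= p)%E -> 0 <= a ->
  lpnorm p (fun i => a * x i) = a * lpnorm p x.
Proof.
move=> + a0; case: p => [r| |] //= => [|_].
  rewrite lee_fin => r1; have r0 : 0 < r by apply: lt_le_trans r1.
  under eq_bigr do rewrite normrM (ger0_norm a0) powRM //.
  rewrite -mulr_sumr powRM ?powR_ge0 //; last first.
    by apply: sumr_ge0 => i _; apply: powR_ge0.
  by rewrite -powRrM mulfV ?lt0r_neq0 // powRr1.
under eq_bigr do rewrite normrM (ger0_norm a0).
apply: (big_ind2 (fun u v => u = a * v)); rewrite ?mulr0 //.
by move=> u1 u2 v1 v2 -> ->; rewrite maxr_pMr.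
Qed.

Lemma lpnormN p x : lpnorm p (fun i => - x i) = lpnorm p x.
Proof.
case: p => [r| |]; rewrite /lpnorm; first congr (_ `^ _).
- by apply: eq_bigr => i _; rewrite normrN.
- by apply: eq_bigr => i _; rewrite normrN.
- by [].
Qed.

Lemma lpnorm_unit_exists p : (1%:E <= p)%E -> (0 < #|I|)%N ->
  exists x : I -> R, lpnorm p x = 1.
Proof.
move=> p1 /card_gt0P [i _].
pose u : I -> R := fun=> 1.
have n0 : 0 < lpnorm p u.
  by apply: lt_le_trans (@normr_le_lpnorm p u i p1); rewrite normr1.
exists (fun i => (lpnorm p u)^-1 * u i).
by rewrite lpnormZ // ?invr_ge0 ?ltW // mulVf // gt_eqF.
Qed.
End LpNorm.

(** * The norm of a multilinear functional *)

Section TensorNorm.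
Context {R : realType} {J : finType} {E : J -> finType}.
Context (p : \bar R) (T : {dffun forall j, E j} -> R).
Hypothesis p1 : (1%:E <= p)%E.

Let form (x : forall j, E j -> R) := \sum_m T m * \prod_j x j (m j).

Lemma form_le_tensor_norm_unit x : (forall j, lpnorm p (x j) = 1) ->
  form x <= tensor_norm p T.
Proof.
move=> x1; apply: ub_le_sup; last by exists x.
(* Entries of unit vectors have absolute value at most 1, so this bounds the form. *)
exists (\sum_m `|T m|) => _ [y [y1 ->]].
apply: ler_sum => m _; apply: (le_trans (ler_norm _)).
rewrite normrM ler_piMr // normr_prod prodr_ile1 // => j _.
by rewrite normr_ge0 -(y1 j) normr_le_lpnorm.
Qed.

(** By multilinearity each vector can be normalised, unless one has norm zero, and then both sides
    vanish. Slices are not unit vectors and need this form. *)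
Lemma form_le_tensor_norm x :
  form x <= tensor_norm p T * \prod_j lpnorm p (x j).
Proof.
have [[j0 xj0]|x0] := pselect (exists j, lpnorm p (x j) = 0).
  rewrite /form (bigD1 j0) //= xj0 mul0r mulr0 big1 // => m _.
  have : `|x j0 (m j0)| <= 0 by rewrite -xj0 normr_le_lpnorm.
  by rewrite normr_le0 => /eqP x00; rewrite (bigD1 j0) //= x00 mul0r mulr0.
have xgt0 j : 0 < lpnorm p (x j).
  by rewrite lt_def lpnorm_ge0 andbT; apply/eqP => xj; apply: x0; exists j.
rewrite -ler_pdivrMr; last exact: prodr_gt0.
have -> : form x / \prod_j lpnorm p (x j) =
    form (fun j e => (lpnorm p (x j))^-1 * x j e).
  rewrite -prodfV mulrC /form mulr_sumr; apply: eq_bigr => m _.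
  by rewrite mulrCA -big_split.
apply: form_le_tensor_norm_unit => j.
by rewrite lpnormZ ?invr_ge0 ?lpnorm_ge0 // mulVf // gt_eqF.
Qed.

Lemma lpnorm_unit_family : (forall j, (0 < #|E j|)%N) ->
  exists x : forall j, E j -> R, forall j, lpnorm p (x j) = 1.
Proof.
move=> E0; pose x1 j := cid (@lpnorm_unit_exists R (E j) p p1 (E0 j)).
by exists (fun j => projT1 (x1 j)) => j; exact: (projT2 (x1 j)).
Qed.

Lemma tensor_norm_le (C : R) : (forall j, (0 < #|E j|)%N) ->
  (forall x : forall j, E j -> R, (forall j, lpnorm p (x j) = 1) -> form x <= C) ->
  tensor_norm p T <= C.
Proof.
move=> E0 xC; apply: ge_sup => [|_ [x [x1 ->]]]; last exact: xC.
have [x x1] := lpnorm_unit_family E0.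
by eexists; exists x; split.
Qed.

(** Negating the vector at [j0] negates the form, so the norm bounds both a number and its
    opposite. *)
Lemma tensor_norm_ge0 (j0 : J) : (forall j, (0 < #|E j|)%N) ->
  0 <= tensor_norm p T.
Proof.
move=> E0.
have [x x1] := lpnorm_unit_family E0.
pose y j := if j == j0 then fun e => - x j e else x j.
have y1 j : lpnorm p (y j) = 1 by rewrite /y; case: ifP; rewrite ?lpnormN x1.
have : form y = - form x.
  rewrite /form -sumrN; apply: eq_bigr => m _.
  rewrite (bigD1 j0) //= [in RHS](bigD1 j0) //= {1}/y eqxx mulNr mulrN.
  congr (- (_ * (_ * _))); apply: eq_bigr => j jj0.
  by rewrite /y (negbTE jj0).
have := form_le_tensor_norm_unit _ y1; have := form_le_tensor_norm_unit _ x1; lra.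
Qed.
End TensorNorm.

(** Hoelder's inequality against the all-ones vector, by summing Young's inequality. The case
    [r = 1] is separate because the conjugate exponent is then infinite. *)
Lemma sum_le_card_powR {R : realType} (I : finType) (r : R) (a : I -> R) :
  1 <= r -> (forall i, 0 <= a i) -> \sum_i a i `^ r = 1 ->
  \sum_i a i <= #|I|%:R `^ (1 - r^-1).
Proof.
move=> r1 a0 a1; have r0 : 0 < r by apply: lt_le_trans r1.
have [re|rn1] := eqVneq r 1.
  rewrite re invr1 subrr powRr0 -a1 le_eqVlt; apply/orP; left; apply/eqP.
  by apply: eq_bigr => i _; rewrite re powRr1.
have n0 : 0 < #|I|%:R :> R.
  rewrite ltr0n lt0n; apply/eqP => I0; move/eqP: a1.
  rewrite big_pred0; last by move=> i; have := card0_eq I0 i.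
  by rewrite eq_sym oner_eq0.
have s0 : 0 < 1 - r^-1 by rewrite subr_gt0 invf_lt1 // lt_def rn1.
set s := 1 - r^-1 in s0 *.
(* Young's inequality with the constant [#|I| ^ (- s)], [s] the inverse of the
   exponent conjugate to [r]. *)
have Y i : a i * #|I|%:R `^ (- s) <= a i `^ r / r + #|I|%:R^-1 * s.
  have := @conjugate_powR R (a i) (#|I|%:R `^ (- s)) r s^-1.
  rewrite invrK -powRrM mulNr mulfV ?gt_eqF // powR_inv1 ?ler0n //.
  by apply; rewrite ?powR_ge0 ?invr_gt0 // /s; lra.
have : (\sum_i a i) * #|I|%:R `^ (- s) <= 1.
  rewrite mulr_suml (le_trans (ler_sum _ (fun i _ => Y i))) //.
  rewrite big_split /= -mulr_suml a1 sumr_const.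
  rewrite -mulrnAl -[_ *+ #|_|]mulr_natr mulVf ?gt_eqF //.
  by rewrite /s; lra.
by rewrite powRN ler_pdivrMr ?powR_gt0 // mul1r.
Qed.

(** * Multi-indices and their restrictions to the blocks of a partition *)

Section Restriction.
Context {k : nat} {d : 'I_k -> nat}.
Implicit Types (B : {set 'I_k}) (P : {set {set 'I_k}}) (i : tindex d).

(** [i0] is a filler off [B]; matching on [@idP] yields the membership proof that [m] takes as
    argument. *)
Definition extend (i0 : tindex d) B (m : blockidx d B) : tindex d :=
  [ffun n => match @idP (n \in B) with
             | ReflectT h => m (exist _ n h)
             | ReflectF _ => i0 n
             end].

Lemma extendK i0 B (m : blockidx d B) : restr B (extend i0 B m) = m.
Proof.
apply/ffunP => -[n nB]; rewrite !ffunE /=.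
by case: {-}_ / idP => [h|/(_ nB)] //; rewrite (bool_irrelevance h nB).
Qed.

Lemma eq_restrP B i i' : (restr B i = restr B i') <->
  (forall n, n \in B -> i n = i' n).
Proof.
split=> [ii' n nB|ii'].
  by have /ffunP/(_ (exist _ n nB)) := ii'; rewrite !ffunE.
by apply/ffunP => -[n nB]; rewrite !ffunE /= ii'.
Qed.

Lemma card_blockidx B : #|blockidx d B| = (\prod_(n in B) d n)%N.
Proof.
rewrite card_dffun (big_sub (mem B)) /=.
by apply: eq_bigr => r _; rewrite card_ord.
Qed.

Context {P : {set {set 'I_k}}}.
Hypothesis partP : is_partition P.

Lemma block_subproof (n : 'I_k) : finset.pblock P n \in P.
Proof. by rewrite finset.pblock_mem // (finset.cover_partition partP) finset.in_setT. Qed.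

Definition block n : blocks P := exist _ (finset.pblock P n) (block_subproof n).

Lemma mem_block n : n \in val (block n).
Proof. by rewrite /= finset.mem_pblock (finset.cover_partition partP) finset.in_setT. Qed.

Lemma blockE n (B : blocks P) : n \in val B -> block n = B.
Proof.
move=> nB; apply: val_inj; apply: finset.def_pblock nB; last exact: valP.
by case/and3P: partP.
Qed.

(** As the blocks partition the modes, a multi-index amounts to an independent choice of its
    restrictions ([split], with inverse [glue]), so distributivity applies. *)
Lemma sum_prod_restr {R : comPzSemiRingType} (i0 : tindex d)
    (f : forall B : blocks P, blockidx d (val B) -> R) :
  \sum_i \prod_B f B (restr (val B) i) = \prod_B \sum_m f B m.
Proof.
rewrite -sum_prod_dffun.
pose glue (m : unfold_idx d P) : tindex d :=
  [ffun n => extend i0 _ (m (block n)) n].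
have glueK m (B : blocks P) : restr (val B) (glue m) = m B.
  rewrite -[RHS](extendK i0); apply/eq_restrP => n /blockE <-.
  by rewrite ffunE.
pose split i : unfold_idx d P := [ffun B => restr (val B) i].
rewrite [RHS](reindex split) /=; last first.
  exists glue => [i|m] _; last by apply/ffunP => B; rewrite ffunE glueK.
  apply/ffunP => n; rewrite ffunE.
  have /eq_restrP -> // : restr (val (block n)) (extend i0 _ (split i (block n))) =
     restr (val (block n)) i by rewrite extendK ffunE.
  exact: mem_block.
by apply: eq_bigr => i _; apply: eq_bigr => B _; rewrite ffunE.
Qed.

(** Puts the forms of all unfoldings on the same index set. Once the sums are exchanged, each [i]
    meets a single [m], the tuple of its restrictions. *)
Lemma Unfold_form {R : comPzRingType} (A : tindex d -> R)
    (x : forall B : blocks P, blockidx d (val B) -> R) :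
  \sum_(m : unfold_idx d P) Unfold A m * \prod_B x B (m B) =
  \sum_i A i * \prod_B x B (restr (val B) i).
Proof.
under eq_bigr do rewrite mulr_suml.
rewrite (exchange_big_dep predT) //=; apply: eq_bigr => i _.
rewrite (big_pred1 ([ffun B => restr (val B) i] : unfold_idx d P)) /=.
  by congr (_ * _); apply: eq_bigr => B _; rewrite ffunE.
move=> m; apply/forallP/eqP => [h|-> B]; last by rewrite ffunE.
by apply/ffunP => B; rewrite ffunE; apply/esym/eqP/h.
Qed.

End Restriction.

(** * Cutting a product of vectors into slices *)

Lemma prod_norm_powR {R : realType} (I : finType) (r : R) (f : I -> R) :
  `|\prod_i f i| `^ r = \prod_i `|f i| `^ r.
Proof.
apply: (big_morph (fun y => `|y| `^ r)) => [y z|].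
  by rewrite normrM powRM.
by rewrite normr1 powR1.
Qed.

Section Slices.
Context {R : realType} {k : nat} {d : 'I_k -> nat} (i0 : tindex d).
Context {P1 P2 : {set {set 'I_k}}}.
Hypotheses (partP1 : is_partition P1) (partP2 : is_partition P2).
Context (c : blocks P2 -> blocks P1) (O : {set 'I_k}).
Hypothesis cO : forall (B : blocks P2) n, n \in val B -> n \notin O -> n \in val (c B).

(* The [j]-th slice; for [B] over [B'] the modes in [B] outside [O] lie in [B'],
   so the entries of [x B] involved depend on [j] and [m] only. *)
Definition slice (x : forall B : blocks P2, blockidx d (val B) -> R)
    (j : blockidx d O) (B' : blocks P1) (m : blockidx d (val B')) : R :=
  let e := extend i0 _ m in
  let t := extend i0 _ j in
  [forall n, (n \in O) && (n \in val B') ==> (e n == t n)]%:R *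
  \prod_(B | c B == B')
     x B (restr (val B) [ffun n => if n \in O then t n else e n]).

Variable x : forall B : blocks P2, blockidx d (val B) -> R.

(** The blocks of [P1] cover all modes, so their indicators jointly test whether [i] agrees with [j]
    on [O]; the other factors are the [x B] regrouped along [c]. *)
Lemma prod_slice j (i : tindex d) :
  \prod_B' slice x j B' (restr (val B') i) =
  (restr O i == j)%:R * \prod_B x B (restr (val B) i).
Proof.
have extE (B : {set 'I_k}) n : n \in B -> extend i0 B (restr B i) n = i n.
  by move: n; apply/eq_restrP; rewrite extendK.
have [<-|ij] := eqVneq (restr O i) j.
  rewrite mul1r (partition_big c predT) //=; apply: eq_bigr => B' _.
  rewrite /slice; set b := [forall n, _].
  have -> : b by apply/forallP => n; apply/implyP => /andP[nO nB]; rewrite !extE.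
  rewrite mul1r; apply: eq_bigr => B /eqP cB; congr (x B _).
  apply/eq_restrP => n nB; rewrite ffunE.
  by case: ifPn => nO; rewrite extE // -cB cO.
(* At a mode [n] of disagreement, the indicator for the block of [P1] through [n] vanishes. *)
have [n nO nij] : exists2 n, n \in O & i n != extend i0 O j n.
  apply/exists_inP; apply: contraNT ij; rewrite negb_exists => /forallP h.
  apply/eqP; rewrite -[RHS](extendK i0); apply/eq_restrP => n nO.
  by have := h n; rewrite nO negbK => /eqP.
rewrite mul0r (bigD1 (block partP1 n)) //= {1}/slice.
set b := [forall n, _]; suff -> : b = false by rewrite !mul0r.
apply/negbTE/forallPn; exists n.
by rewrite nO mem_block /= extE // mem_block.
Qed.

Lemma sum_prod_slice (F : tindex d -> R) :
  \sum_j \sum_i F i * \prod_B' slice x j B' (restr (val B') i) =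
  \sum_i F i * \prod_B x B (restr (val B) i).
Proof.
rewrite exchange_big; apply: eq_bigr => i _.
rewrite (bigD1 (restr O i)) // -[RHS]addr0; congr (_ + _).
  by rewrite prod_slice eqxx mul1r.
by apply: big1 => j /andP[_ ji]; rewrite prod_slice eq_sym (negbTE ji) mul0r mulr0.
Qed.

Lemma normr_slice_le1 j B' m :
  (forall B m', `|x B m'| <= 1) -> `|slice x j B' m| <= 1.
Proof.
move=> x1; rewrite normrM normr_prod mulr_ile1 //.
- exact: prodr_ge0.
- by case: [forall n, _]; rewrite ?normr0 ?normr1 // ler01.
- by apply: prodr_ile1 => B _; rewrite normr_ge0 x1.
Qed.

Lemma sum_prod_lpnorm_slice (p : \bar R) : (1%:E <= p)%E ->
  (forall B, lpnorm p (x B) = 1) ->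
  \sum_j \prod_B' lpnorm p (slice x j B') <= #|blockidx d O|%:R `^ (1 - invp p).
Proof.
case: p => [r| |] // p1 x1; last first.
  (* For [p = +oo] all entries of a slice are at most 1 in absolute value, so each summand is at
     most 1. *)
  rewrite subr0 powRr1 ?ler0n // -sumr_const; apply: ler_sum => j _.
  apply: prodr_ile1 => B' _; rewrite lpnorm_ge0 /=.
  apply: bigmax_le => // m _; apply: normr_slice_le1 => B m'.
  by rewrite -(x1 B) normr_le_lpnorm.
have r1 : 1 <= r by rewrite -lee_fin.
have r0 : r != 0 by rewrite gt_eqF // (lt_le_trans ltr01).
apply: sum_le_card_powR => // [j|].
  by apply: prodr_ge0 => B' _; apply: lpnorm_ge0.
transitivity (\sum_j \sum_i \prod_B' `|slice x j B' (restr (val B') i)| `^ r).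
  apply: eq_bigr => j _.
  rewrite (sum_prod_restr partP1 i0 (fun B' m => `|slice x j B' m| `^ r)).
  rewrite -[X in X `^ r]ger0_norm; last first.
    by apply: prodr_ge0 => B' _; apply: lpnorm_ge0.
  rewrite prod_norm_powR; apply: eq_bigr => B' _.
  by rewrite ger0_norm ?lpnorm_ge0 // lpnorm_powR.
rewrite exchange_big.
(* Each [i] belongs only to the slice [j = restr O i], so the double sum collapses; what remains
   factors over the blocks of [P2] into powers of unit norms. *)
transitivity (\sum_(i : tindex d) \prod_B `|x B (restr (val B) i)| `^ r).
  apply: eq_bigr => i _; rewrite (bigD1 (restr O i)) // -[RHS]addr0; congr (_ + _).
    by rewrite -!prod_norm_powR prod_slice eqxx mul1r.
  apply: big1 => j /andP[_ ji]; rewrite -prod_norm_powR prod_slice eq_sym (negbTE ji) mul0r.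
  by rewrite normr0 powR0.
rewrite (sum_prod_restr partP2 i0 (fun B m => `|x B m| `^ r)).
by apply: big1 => B _; rewrite -lpnorm_powR // x1 powR1.
Qed.
End Slices.

(** * Comparison of the norms of two unfoldings *)

Lemma blockidx_gt0 (k : nat) (d : 'I_k -> nat) (B : {set 'I_k}) :
  (forall n, (0 < d n)%N) -> (0 < #|blockidx d B|)%N.
Proof. by move=> d0; rewrite card_blockidx prodn_gt0. Qed.

Lemma unfold_norm_le_slices {R : realType} {k : nat} {d : 'I_k -> nat}
    (p : \bar R) (P1 P2 : {set {set 'I_k}}) (A : tindex d -> R)
    (c : blocks P2 -> blocks P1) (O : {set 'I_k}) :
  (forall n, (0 < d n)%N) -> is_partition P1 -> is_partition P2 ->
  (forall (B : blocks P2) n, n \in val B -> n \notin O -> n \in val (c B)) ->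
  (1%:E <= p)%E -> 0 <= unfold_norm p P1 A ->
  unfold_norm p P2 A <= #|blockidx d O|%:R `^ (1 - invp p) * unfold_norm p P1 A.
Proof.
move=> d0 partP1 partP2 cO p1 N0.
pose i0 : tindex d := [ffun n => Ordinal (d0 n)].
apply: tensor_norm_le => // [B|x x1]; first exact: blockidx_gt0.
rewrite Unfold_form -(sum_prod_slice i0 partP1 c O cO x A).
apply: le_trans (ler_wpM2r N0 (sum_prod_lpnorm_slice i0 partP1 partP2 c O cO x p p1 x1)).
rewrite mulr_suml; apply: ler_sum => j _; rewrite -Unfold_form mulrC.
exact: form_le_tensor_norm.
Qed.

(** Disjoint blocks have [DA] equal to 0, not the empty product 1. A maximiser does meet [B], since
    the block through a point of [B] has positive overlap. *)
Lemma max_overlap {k : nat} (d : 'I_k -> nat) (P : {set {set 'I_k}})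
    (B : {set 'I_k}) : (forall n, (0 < d n)%N) -> is_partition P ->
  B != finset.set0 ->
  exists B' : blocks P, (\max_(B1 in P) DA d B B1 = \prod_(n in B :&: val B') d n)%N.
Proof.
move=> d0 partP /set0Pn [n nB].
have P0 : (0 < #|P|)%N.
  by apply/card_gt0P; exists (val (block partP n)); apply: valP.
have [B' B'P maxE] := eq_bigmax_cond (DA d B) P0.
exists (exist _ B' B'P) => /=; rewrite maxE /DA.
case: ifPn => // BB'; exfalso.
have : (DA d B (val (block partP n)) <= DA d B B')%N.
  by rewrite -maxE leq_bigmax_cond // (valP (block partP n)).
rewrite {2}/DA (negbTE BB') leqn0 /DA.
case: ifPn => [_|/negP[]]; first by rewrite -leqn0 leqNgt prodn_gt0.
by apply/set0Pn; exists n; rewrite finset.inE nB mem_block.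
Qed.

(** The modes in [O] contribute the first factor; those outside, grouped by blocks of [P2],
    contribute the maximal overlaps. *)
Lemma dimA2_split {k : nat} (d : 'I_k -> nat) (P1 P2 : {set {set 'I_k}}) :
  (forall n, (0 < d n)%N) -> is_partition P1 -> is_partition P2 ->
  exists (c : blocks P2 -> blocks P1) (O : {set 'I_k}),
    (forall (B : blocks P2) n, n \in val B -> n \notin O -> n \in val (c B)) /\
    dimA d = (#|blockidx d O| * dimA2 d P2 P1)%N.
Proof.
move=> d0 partP1 partP2.
have /choice [c cE] (B : blocks P2) : exists B' : blocks P1,
    (\max_(B1 in P1) DA d (val B) B1 = \prod_(n in val B :&: val B') d n)%N.
  apply: max_overlap => //; apply: contraTneq (valP B) => ->.
  by case/and3P: partP2.
pose O := finset (fun n => n \notin val (c (block partP2 n))).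
exists c, O; split=> [B n nB|].
  by rewrite finset.inE negbK (blockE partP2 n B nB).
rewrite card_blockidx /dimA (bigID (mem O)) /=; congr (_ * _)%N.
rewrite /dimA2 (big_sub (mem P2)) /=.
rewrite (eq_bigl (fun n => (n \in [set: 'I_k]) && (n \notin O))); last first.
  by move=> n; rewrite finset.in_setT.
rewrite (set_partition_big_cond _ partP2) (big_sub (mem P2)) /=.
apply: eq_bigr => B _; rewrite cE; apply: eq_bigl => n.
rewrite !finset.inE negbK; case nB: (n \in _) => //=.
by rewrite (blockE partP2 n B nB).
Qed.

(** Write [dimA d] as N D with D = [dimA2 d P2 P1]. The constant is N^e D^(e - 1/2), which is at
    least N^(1 - 1/p) because N and D are at least 1. *)
Lemma unfold_norm_le {R : realType} {k : nat} {d : 'I_k -> nat}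
    (A : tindex d -> R) (P1 P2 : {set {set 'I_k}}) (p : \bar R) (e : R) :
  (forall n, (0 < d n)%N) -> is_partition P1 -> is_partition P2 ->
  (1%:E <= p)%E -> 2^-1 <= e -> 1 - invp p <= e ->
  unfold_norm p P2 A <=
    ((dimA d)%:R `^ e / (dimA2 d P2 P1)%:R `^ 2^-1) * unfold_norm p P1 A.
Proof.
move=> d0 partP1 partP2 p1 e2 ep.
(* If [k = 0] then [unfold_norm p P1 A] is the only entry of [A], possibly
   negative. *)
have [P10|[B1 B1P]] := set_0Vmem P1.
  have I0 (n : 'I_k) : False.
    have := finset.in_setT n; rewrite -(finset.cover_partition partP1) P10.
    by rewrite /finset.cover finset.big_set0 finset.inE.
  have -> : P2 = P1.
    rewrite P10; apply/setP => B; rewrite finset.inE; apply: contraTF partP2 => BP2.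
    have [B0|[n _]] := set_0Vmem B; last by case: (I0 n).
    by apply: contraL BP2 => /and3P[_ _]; rewrite B0.
  rewrite /dimA big1 => [|n]; last by case: (I0 n).
  by rewrite /dimA2 P10 finset.big_set0 !powR1 divr1 mul1r.
have N0 : 0 <= unfold_norm p P1 A.
  apply: (tensor_norm_ge0 _ _ p1 (exist _ B1 B1P)) => B; exact: blockidx_gt0.
have [c [S [cO DE]]] := dimA2_split d P1 P2 d0 partP1 partP2.
rewrite [X in X%:R `^ e]DE.
apply: le_trans (unfold_norm_le_slices p P1 P2 A c S d0 partP1 partP2 cO p1 N0) _.
apply: ler_wpM2r => //.
have n1 : 1 <= #|blockidx d S|%:R :> R by rewrite ler1n blockidx_gt0.
have D1 : 1 <= (dimA2 d P2 P1)%:R :> R.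
  have : (0 < dimA d)%N by rewrite prodn_gt0.
  by rewrite DE muln_gt0 ler1n => /andP[].
have D0 := lt_le_trans ltr01 D1.
rewrite natrM powRM ?ler0n // -mulrA -powRB; last by rewrite (gt_eqF D0) implybT.
rewrite -[X in X <= _]mulr1; apply: ler_pM => //; rewrite ?powR_ge0 //.
  exact: ler_powR.
by rewrite -[X in X <= _](powRr0 (dimA2 d P2 P1)%:R) ler_powR // subr_ge0.
Qed.

Theorem theorem4p16 (R : realType) (k : nat) (d : 'I_k -> nat)
    (A : tindex d -> R) (P1 P2 : {set {set 'I_k}}) :
  (forall n : 'I_k, (0 < d n)%N) ->
  is_partition P1 -> is_partition P2 ->
  (forall p : \bar R, (1%:E <= p <= 2%:E)%E ->
     ((dimA d)%:R `^ (- invp p) / (dimA2 d P1 P2)%:R `^ (- 2^-1))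
       * unfold_norm p P1 A <= unfold_norm p P2 A /\
     unfold_norm p P2 A <=
       ((dimA d)%:R `^ (invp p) / (dimA2 d P2 P1)%:R `^ (2^-1))
       * unfold_norm p P1 A) /\
  (forall p : \bar R, (2%:E <= p <= +oo)%E ->
     ((dimA d)%:R `^ (invp p - 1) / (dimA2 d P1 P2)%:R `^ (- 2^-1))
       * unfold_norm p P1 A <= unfold_norm p P2 A /\
     unfold_norm p P2 A <=
       ((dimA d)%:R `^ (1 - invp p) / (dimA2 d P2 P1)%:R `^ (2^-1))
       * unfold_norm p P1 A).
Proof.
move=> d0 partP1 partP2.
(* The exponent [e] will be 1/p for p at most 2 and 1 - 1/p for p at least 2; in each range it
   dominates both 1/2 and 1 - 1/p. *)
have both (p : \bar R) (e : R) : (1%:E <= p)%E -> 2^-1 <= e -> 1 - invp p <= e ->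
    ((dimA d)%:R `^ (- e) / (dimA2 d P1 P2)%:R `^ (- 2^-1)) * unfold_norm p P1 A <=
      unfold_norm p P2 A /\
    unfold_norm p P2 A <=
      ((dimA d)%:R `^ e / (dimA2 d P2 P1)%:R `^ 2^-1) * unfold_norm p P1 A.
  move=> p1 e2 ep; split; last exact: unfold_norm_le.
  have N12 := unfold_norm_le A P2 P1 p e d0 partP2 partP1 p1 e2 ep.
  have [c [S [_ DE]]] := dimA2_split d P2 P1 d0 partP2 partP1.
  have : (0 < dimA d)%N by rewrite prodn_gt0.
  rewrite {1}DE muln_gt0 => /andP[_ D2].
  have D : (0 < dimA d)%N by rewrite prodn_gt0.
  have De : 0 < (dimA d)%:R `^ e :> R by rewrite powR_gt0 ?ltr0n.
  have D2e : 0 < (dimA2 d P1 P2)%:R `^ 2^-1 :> R by rewrite powR_gt0 ?ltr0n.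
  (* Solving [N12] for the norm over [P2] gives the lower bound. *)
  rewrite !powRN invrK -mulrA ler_pdivrMl // -ler_pdivlMl // mulrA.
  by rewrite [_^-1 * _]mulrC.
split=> [[r| |]|[r| |]] /andP[] //.
- rewrite !lee_fin => r1 r2; have r0 : 0 < r by apply: lt_le_trans r1.
  have h : 2^-1 <= r^-1 by rewrite lef_pV2 // posrE.
  by apply: both; rewrite /= ?lee_fin //; lra.
- rewrite !lee_fin => r2 _; have r0 : 0 < r by apply: lt_le_trans r2.
  have h : r^-1 <= 2^-1 by rewrite lef_pV2 // posrE.
  rewrite -[_ - 1]opprB; apply: both; rewrite /= ?lee_fin //; last by lra.
  by apply: le_trans r2; rewrite ler1n.
- by move=> _ _; rewrite -[_ - 1]opprB; apply: both; rewrite ?leey //=; lra.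
Qed.
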